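(* Let $\mathcal{L}$ be a commutative subspace lattice on a separable Hilbert space $\mathcal{H}$. The following statements are equivalent. \begin{enumerate} \item $\mathcal{L}$ is a hyperatomic CSL. \item Every invariant linear manifold for $\operatorname{Alg}\mathcal{L}$ is closed, i.e., $\operatorname{Man}(\operatorname{Alg}\mathcal{L})=\mathcal{L}$. \item Every singly generated invariant linear manifold for $\operatorname{Alg}\mathcal{L}$ is closed. \item Every element of $\mathcal{L}$ is singly generated; that is, for every $P\in\mathcal{L}$ there exists a vector $x\in P\mathcal{H}$ such that $\{(\operatorname{Alg}\mathcal{L})x\}=P\mathcal{H}$. \item Every invariant linear manifold for $\operatorname{Alg}\mathcal{L}$ is singly generated. \end{enumerate}
   Context: All Hilbert spaces are separable. A commutative subspace lattice (CSL) $\mathcal{L}$ on $\mathcal{H}$ is a strongly closed lattice of mutually commuting orthogonal projections containing $0$ and $I$; projections are identified with their (closed) ranges. $\operatorname{Alg}\mathcal{L}$ is the algebra of all $T\in\mathcal{B}(\mathcal{H})$ with $T(P\mathcal{H})\subseteq P\mathcal{H}$ for all $P\in\mathcal{L}$. An atom of $\mathcal{L}$ is a minimal non-zero interval: a non-zero projection of the form $E-F$ with $E,F\in\mathcal{L}$, $F\le E$, that contains no strictly smaller non-zero projection of this form. For atoms $A_1,\dots,A_k$, $E(A_1,\dots,A_k)$ denotes the smallest projection in $\mathcal{L}$ containing $A_1,\dots,A_k$. A projection $P\in\mathcal{L}$ is hyperatomic if $P=E(A_1,\dots,A_k)$ for some finite collection of atoms of $\mathcal{L}$; $\mathcal{L}$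 is hyperatomic if every non-zero projection in $\mathcal{L}$ is hyperatomic. For an operator algebra $\mathcal{A}\subseteq\mathcal{B}(\mathcal{H})$ (not necessarily closed), an invariant linear manifold for $\mathcal{A}$ is a linear subspace (not necessarily closed) $\mathcal{M}$ of $\mathcal{H}$ with $A\mathcal{M}\subseteq\mathcal{M}$ for all $A\in\mathcal{A}$; $\operatorname{Man}\mathcal{A}$ is the set of all of these. For $x\in\mathcal{H}$, $\{\mathcal{A}x\}=\{Ax: A\in\mathcal{A}\}$. An invariant linear manifold $\mathcal{M}$ is singly generated if $\mathcal{M}=\{\mathcal{A}x\}$ for some $x\in\mathcal{H}$, whether or not $\mathcal{M}$ is closed. *)

(* Defs.v *)
From HB Require Import structures.
From mathcomp Require Export all_boot all_order all_algebra.
From mathcomp Require Export complex.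
From mathcomp Require Export boolp classical_sets functions cardinality reals.
From mathcomp Require Export topology normedtype.

Set Implicit Arguments.
Unset Strict Implicit.
Unset Printing Implicit Defensive.

Import Order.TTheory GRing.Theory Num.Theory.
Import numFieldNormedType.Exports.
Local Open Scope classical_set_scope.
Local Open Scope ring_scope.
Local Open Scope complex_scope.


Definition separable (T : topologicalType) : Prop :=
  exists2 D : set T, countable D & dense D.

(* A complex Hilbert space is a complete normed space over R[i] whose norm
   comes from an inner product, linear in its first argument. *)
Definition hilbert_norm (R : realType) (H : normedModType R[i])
    (dot : {dot H for Num.conj}) : Prop :=
  forall x : H, `|x| ^+ 2 = dot x x.

Section Operators.
Context {R : realType} {H : normedModType R[i]}.
Implicit Types (T E F P Q : H -> H) (L B : set (H -> H)) (M : set H).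

Definition bounded_operator T : Prop :=
  linear T /\ exists C : R[i], forall x, `|T x| <= C * `|x|.

Definition orthogonal_projection (dot : {dot H for Num.conj}) P : Prop :=
  [/\ bounded_operator P, P \o P = P
    & forall x y, dot (P x) y = dot x (P y)].

Definition le_proj P Q : Prop := range P `<=` range Q.

(* The lattice operations are those of all projections: the meet projects on
   the intersection of the ranges, the join on the closed span of their union.
   The strong operator topology is the topology of pointwise norm
   convergence. *)
Definition csl (dot : {dot H for Num.conj}) L : Prop :=
  [/\ L `<=` orthogonal_projection dot,
      L (cst 0) /\ L id,
      forall P Q, L P -> L Q -> P \o Q = Q \o P,
      forall P Q, L P -> L Q ->
        (exists2 E, L E & range E = range P `&` range Q) /\
        (exists2 E, L E &
           range E = closure [set x + y | x in range P & y in range Q])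
    & forall T, bounded_operator T ->
        closure (L : set {ptws H -> H}) T -> L T].

Definition Alg L : set (H -> H) :=
  [set T | bounded_operator T /\
           forall P, L P -> T @` range P `<=` range P].

(* Intervals of L, as projections E - F. *)
Definition interval_of L P : Prop :=
  exists E F, [/\ L E, L F, le_proj F E & P = E \- F].

Definition atom L P : Prop :=
  [/\ interval_of L P, P <> cst 0
    & forall Q, interval_of L Q -> Q <> cst 0 -> le_proj Q P -> Q = P].

Definition smallest_containing L k (A : 'I_k -> (H -> H)) E : Prop :=
  [/\ L E, forall i, le_proj (A i) E
    & forall F, L F -> (forall i, le_proj (A i) F) -> le_proj E F].

Definition hyperatomic_proj L P : Prop :=
  exists k (A : 'I_k -> (H -> H)),
    (forall i, atom L (A i)) /\ smallest_containing L A P.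

Definition hyperatomic L : Prop :=
  forall P, L P -> P <> cst 0 -> hyperatomic_proj L P.

Definition Man B : set (set H) :=
  [set M : set H | submod_closed [in M] /\ forall T, B T -> T @` M `<=` M].

Definition cyclic_manifold B (x : H) : set H := [set T x | T in B].

Definition singly_generated B M : Prop := exists x, M = cyclic_manifold B x.

End Operators.

(* Main.v *)
Require Import Defs.
From mathcomp Require Import all_boot all_order all_algebra complex.
From mathcomp Require Import boolp classical_sets functions cardinality reals.
From mathcomp Require Import topology normedtype.
From mathcomp Require Import ring lra.
Import Order.TTheory GRing.Theory Num.Theory.
Import numFieldNormedType.Exports.
Local Open Scope classical_set_scope.
Local Open Scope ring_scope.
Local Open Scope complex_scope.

(** Every projection Q in L either contains an atom A or annihilates it.  Hence,
    for a vector u with A u <> 0 and y in E(A), the rank one operator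
    z |-> <z, A u> y leaves every range in L invariant, and it sends u to a
    nonzero multiple of y: an invariant manifold on which A does not vanish
    contains all of E(A) ([atom_in_manifold]).

    Suppose that L is hyperatomic.  Let M be an invariant manifold, P the
    smallest element of L containing M and P = E(A_1, ..., A_k) with k minimal.
    By minimality, the vectors of P killed by A_i lie in an element of L that is
    orthogonal to A_i ([irredundant_atoms]), so no A_i vanishes on M.  Thus M
    contains each E(A_i), hence their finite algebraic sum, which is P
    ([Man_sub_range]).  So every invariant manifold is the range of an element
    of L, and it is generated by any of its vectors x such that A_i x <> 0 for
    all i ([hyperatomic_cyclic]).

    Conversely, let P in L be the smallest element of L containing x, and let
    the cyclic manifold of x be closed.  Then the norms of x - Q x, for Q < P
    in L, are bounded away from 0.  Otherwise choose Q_m with these norms at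
    most 4^-m; the sum y of the vectors 2^m (x - Q_m x) lies in the closed
    cyclic manifold, so y = T x with T in Alg L.  The operators I - Q_m are
    commuting projections, so the terms of the sum do not cancel and
    2^n |x - Q_n x| <= |y - Q_n y|, whereas invariance of Q_n under T gives
    |y - Q_n y| <= |T| |x - Q_n x|; these contradict each other for large n
    ([closed_cyclic_hyperatomic]).
    Such a gap c > 0 prevents chains below P from converging to P, so by Zorn's
    lemma each Q < P lies below a maximal one ([coatom_above]).  For Q maximal,
    P - Q is an atom ([coatom_atom]); distinct maximal Q give orthogonal atoms,
    on each of which x has norm at least c, so there are finitely many
    ([coatoms_bounded]), and together they generate P ([gap_hyperatomic]).

    This proves that L is hyperatomic when each P in L has a vector with cyclic
    manifold P.  When all cyclic manifolds are closed, it only applies to the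
    projections generated by one vector.  By separability an arbitrary P is
    generated by countably many of those, hence by countably many atoms, and a
    single vector on which none of these atoms vanishes generates P
    ([hyperatomic_of_closed]). *)

(** * Real-valued norm and inner product *)

Section HilbertLattice.
Local Set Implicit Arguments.
Local Unset Strict Implicit.
Context (R : realType) (H : completeNormedModType R[i])
  (dot : {dot H for Num.conj}) (Hdot : hilbert_norm dot).
Implicit Types (x y z : H) (T E F P Q : H -> H) (L : set (H -> H)).

(** The norm of H takes values in the partially ordered field R[i]; its real
    part lives in the totally ordered field R. *)
Definition nrm x : R := complex.Re `|x|.

Lemma nrmE x : `|x| = (nrm x)%:C.
Proof. by rewrite RRe_real // ger0_real. Qed.

Lemma Re_normK (a : R[i]) : (complex.Re `|a|)%:C = `|a|.
Proof. by rewrite RRe_real // ger0_real. Qed.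

Lemma nrm_ge0 x : 0 <= nrm x.
Proof. by rewrite -ler0c -nrmE. Qed.

Lemma nrm_eq0 x : nrm x = 0 -> x = 0.
Proof. by move=> x0; apply/eqP; rewrite -normr_eq0 nrmE x0. Qed.

Lemma nrm0 : nrm 0 = 0.
Proof. by rewrite /nrm normr0. Qed.

Lemma nrmN x : nrm (- x) = nrm x.
Proof. by rewrite /nrm normrN. Qed.

Lemma nrmD x y : nrm (x + y) <= nrm x + nrm y.
Proof. by rewrite -lecR rmorphD /= -!nrmE ler_normD. Qed.

Lemma nrmB x y : nrm (x - y) <= nrm x + nrm y.
Proof. by rewrite -[nrm y]nrmN nrmD. Qed.

Lemma nrm_distC x y : nrm (x - y) = nrm (y - x).
Proof. by rewrite -nrmN opprB. Qed.

Lemma nrmZ (a : R[i]) x : nrm (a *: x) = complex.Re `|a| * nrm x.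
Proof.
apply: complexI; rewrite -nrmE normrZ rmorphM /= nrmE RRe_real //.
exact: ger0_real.
Qed.

Lemma nrmZr (a : R) x : 0 <= a -> nrm (a%:C *: x) = a * nrm x.
Proof. by move=> a0; rewrite nrmZ ger0_norm ?ler0c. Qed.

Lemma dotE x : dot x x = (nrm x ^+ 2)%:C.
Proof. by rewrite -Hdot nrmE rmorphXn. Qed.

Lemma dotC x y : dot x y = (dot y x)^*%C.
Proof. by rewrite hermC expr0 mul1r. Qed.

Lemma nrm2D x y :
  nrm (x + y) ^+ 2 = nrm x ^+ 2 + nrm y ^+ 2 + 2 * complex.Re (dot x y).
Proof.
apply: complexI; rewrite -dotE linearDl !linearDr /= (dotC y x) !dotE.
have -> : (nrm x ^+ 2 + nrm y ^+ 2 + 2 * complex.Re (dot x y))%:C =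
    (nrm x ^+ 2)%:C + (nrm y ^+ 2)%:C + (dot x y + (dot x y)^*%C).
  case: (dot x y) => a b; apply/eqP; rewrite eq_complex /=.
  by apply/andP; split; apply/eqP; ring.
by rewrite addrA [RHS]addrAC -!addrA; congr (_ + _); rewrite addrCA addrA.
Qed.

Lemma pythagoras x y : dot x y = 0 ->
  nrm (x + y) ^+ 2 = nrm x ^+ 2 + nrm y ^+ 2.
Proof. by move=> xy; rewrite nrm2D xy mulr0 addr0. Qed.

(** Adding a vector at an acute angle does not shorten; this is what prevents
    cancellation in the series of [closed_cyclic_hyperatomic]. *)
Lemma nrm_le_add x y : 0 <= dot x y -> nrm x <= nrm (x + y).
Proof.
rewrite lecE => /andP[_ /= xy]; rewrite -ler_sqr ?nnegrE ?nrm_ge0 // nrm2D.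
have := sqr_ge0 (nrm y); lra.
Qed.

Lemma cauchy_schwarz x y : complex.Re `|dot x y| <= nrm x * nrm y.
Proof.
have [->|/eqP y0] := eqVneq y 0; first by rewrite linear0r normr0 nrm0 mulr0.
have ny : 0 < nrm y.
  by rewrite lt_neqAle nrm_ge0 andbT; apply/eqP => /esym/nrm_eq0.
pose c := dot x y / (nrm y ^+ 2)%:C.
have c0 : (nrm y ^+ 2)%:C != 0 :> R[i].
  by rewrite -[0]/(0%:C) (inj_eq (@complexI R)) expf_neq0 // gt_eqF.
have xE : x = (x - c *: y) + c *: y by rewrite subrK.
have ort : dot (x - c *: y) (c *: y) = 0.
  by rewrite linearZr_LR /= linearBl linearZl_LR /= dotE /c divfK // subrr mulr0.
have := pythagoras ort; rewrite -xE nrmZ => e.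
have cE : complex.Re `|c| * nrm y ^+ 2 = complex.Re `|dot x y|.
  apply: complexI; rewrite rmorphM /= !Re_normK /c normrM normfV.
  by rewrite [`|(_ ^+ 2)%:C|]ger0_norm ?divfK // ler0c sqr_ge0.
rewrite -ler_sqr ?nnegrE ?mulr_ge0 ?nrm_ge0 //; last by rewrite -ler0c Re_normK.
rewrite exprMn e -cE.
have -> : (complex.Re `|c| * nrm y ^+ 2) ^+ 2 =
    (complex.Re `|c| * nrm y) ^+ 2 * nrm y ^+ 2 by ring.
by rewrite mulrDl lerDr mulr_ge0 ?sqr_ge0.
Qed.

(** * Topology in terms of the real-valued norm *)

Lemma ball_nrm x (e : R) y : ball x e%:C y <-> nrm (x - y) < e.
Proof. by rewrite -ball_normE /ball_ /= nrmE ltcR. Qed.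

Lemma nbhs_nrm x (A : set H) :
  nbhs x A <-> exists2 e : R, 0 < e & forall y, nrm (x - y) < e -> A y.
Proof.
split=> [/nbhs_ballP[e /= e0 eA]|[e e0 eA]].
  have eE : e = (complex.Re e)%:C by rewrite RRe_real // gtr0_real.
  exists (complex.Re e) => [|y xy]; first by rewrite -ltcR -eE.
  by apply: eA; rewrite eE; apply/ball_nrm.
apply/nbhs_ballP; exists e%:C => /=; first by rewrite ltcR.
by move=> y /ball_nrm; apply: eA.
Qed.

Lemma closure_nrm (A : set H) x :
  closure A x <-> forall e : R, 0 < e -> exists2 y, A y & nrm (x - y) < e.
Proof.
split=> [Ax e e0|Ax B /nbhs_nrm[e e0 eB]].
  have [|y [Ay By]] := Ax [set y | nrm (x - y) < e]; last by exists y.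
  by apply/nbhs_nrm; exists e.
by have [y Ay xy] := Ax e e0; exists y; split=> //; apply: eB.
Qed.

Lemma cvg_nrm (F : set_system H) {FF : ProperFilter F} :
  (forall e : R, 0 < e -> exists x, F [set y | nrm (x - y) < e]) -> cvg F.
Proof.
move=> hF; apply/cauchy_cvgP/cauchy_exP => e e0.
have eE : e = (complex.Re e)%:C by rewrite RRe_real // gtr0_real.
have [|x Fx] := hF (complex.Re e); first by rewrite -ltcR -eE.
by exists x; apply: filterS Fx => y xy; rewrite eE; apply/ball_nrm.
Qed.

Lemma nrm_small x y : (forall e : R, 0 < e -> nrm (x - y) < e) -> x = y.
Proof.
move=> xy; apply/eqP; rewrite -subr_eq0; apply/eqP/nrm_eq0/eqP.
rewrite eq_le nrm_ge0 andbT leNgt; apply/negP => h.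
by have := xy _ h; rewrite ltxx.
Qed.

(** * Bounded operators and orthogonal projections *)

Lemma bop_bound T : bounded_operator T ->
  exists2 c : R, 0 <= c & forall x, nrm (T x) <= c * nrm x.
Proof.
move=> [_ [C TC]]; exists `|complex.Re C| => // x.
have := TC x; rewrite !nrmE lecE => /andP[_]; case: C {TC} => a b /=.
rewrite mulr0 subr0 => /le_trans; apply.
by rewrite ler_wpM2r ?nrm_ge0 // ler_norm.
Qed.

Lemma mk_bop T (c : R) : linear T -> (forall x, nrm (T x) <= c * nrm x) ->
  bounded_operator T.
Proof.
by move=> Tl Tc; split=> //; exists c%:C => x; rewrite !nrmE -rmorphM lecR.
Qed.

Lemma bopZD T a x y : bounded_operator T -> T (a *: x + y) = a *: T x + T y.
Proof. by case=> + _; apply. Qed.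

Lemma bop0 T : bounded_operator T -> T 0 = 0.
Proof. by move=> b; have := bopZD (-1) 0 0 b; rewrite !scaleN1r oppr0 addr0 addNr. Qed.

Lemma bopZ T a x : bounded_operator T -> T (a *: x) = a *: T x.
Proof. by move=> b; rewrite -[a *: x]addr0 bopZD // bop0 // addr0. Qed.

Lemma bopD T x y : bounded_operator T -> T (x + y) = T x + T y.
Proof. by move=> b; rewrite -[x]scale1r bopZD // !scale1r. Qed.

Lemma bopB T x y : bounded_operator T -> T (x - y) = T x - T y.
Proof. by move=> b; rewrite bopD // -scaleN1r bopZ // scaleN1r. Qed.

Lemma bop_sum T I (r : seq I) (p : pred I) (F : I -> H) : bounded_operator T ->
  T (\sum_(i <- r | p i) F i) = \sum_(i <- r | p i) T (F i).
Proof. by move=> b; apply: big_morph => [x y|]; [exact: bopD | exact: bop0]. Qed.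

Lemma proj_bop P : orthogonal_projection dot P -> bounded_operator P.
Proof. by case. Qed.

Lemma projK P x : orthogonal_projection dot P -> P (P x) = P x.
Proof. by case=> _ /(congr1 (fun f => f x)). Qed.

Lemma proj_dot P x y : orthogonal_projection dot P -> dot (P x) y = dot x (P y).
Proof. by case. Qed.

Lemma proj_pythagoras P x : orthogonal_projection dot P ->
  nrm x ^+ 2 = nrm (P x) ^+ 2 + nrm (x - P x) ^+ 2.
Proof.
move=> pP; rewrite -pythagoras ?subrKC //.
by rewrite proj_dot // (bopB _ _ (proj_bop pP)) projK // subrr linear0r.
Qed.

Lemma proj_nrm P x : orthogonal_projection dot P -> nrm (P x) <= nrm x.
Proof.
move=> pP; rewrite -ler_sqr ?nnegrE ?nrm_ge0 // (proj_pythagoras x pP).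
by rewrite lerDl sqr_ge0.
Qed.

(** Idempotency and self-adjointness make x - P x orthogonal to P x, so by
    Pythagoras P is a contraction. *)
Lemma mk_proj P : linear P -> (forall x, P (P x) = P x) ->
  (forall x y, dot (P x) y = dot x (P y)) -> orthogonal_projection dot P.
Proof.
move=> Pl PP Pd; split=> //; last exact/funext.
have PB x y : P (x - y) = P x - P y.
  by rewrite -[x - y]addrC -scaleN1r Pl scaleN1r addrC.
apply: (mk_bop (c := 1)) => // x; rewrite mul1r.
rewrite -ler_sqr ?nnegrE ?nrm_ge0 // -[x in leRHS](subrKC (P x)) pythagoras.
  by rewrite lerDl sqr_ge0.
by rewrite Pd PB PP subrr linear0r.
Qed.

Lemma rangeP P x : orthogonal_projection dot P -> range P x <-> P x = x.
Proof. by move=> pP; split=> [[y _ <-]|<-]; [exact: projK | exists x]. Qed.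

Lemma proj_eq P Q : orthogonal_projection dot P -> orthogonal_projection dot Q ->
  range P = range Q -> P = Q.
Proof.
move=> pP pQ PQ; apply/funext => x.
have QP y : Q (P y) = P y by apply/rangeP => //; rewrite -PQ; exists y.
have PQy y : P (Q y) = Q y by apply/rangeP => //; rewrite PQ; exists y.
apply/eqP; rewrite -subr_eq0; apply/eqP/nrm_eq0/eqP.
rewrite -sqrf_eq0 -(inj_eq (@complexI R)) -dotE.
rewrite linearBl /= !linearBr /= !proj_dot // PQy QP !projK //.
by rewrite !subrr.
Qed.

Lemma proj_closed P : orthogonal_projection dot P -> closed (range P).
Proof.
move=> pP x /closure_nrm Px; apply/rangeP => //; apply: nrm_small => e e0.
have [|y /(rangeP _ pP) yP xy] := Px (e / 2); first by rewrite divr_gt0.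
rewrite -(subrK y (P x)) -addrA (le_lt_trans (nrmD _ _)) //.
rewrite -{1}yP -(bopB _ _ (proj_bop pP)) [nrm (y - x)]nrm_distC.
have := proj_nrm (x - y) pP; lra.
Qed.

(** Inclusion of the range of P in that of the projection Q, as an equation
    that can be used for rewriting. *)
Definition subproj P Q := forall x, Q (P x) = P x.

Lemma le_projP P Q : orthogonal_projection dot Q -> le_proj P Q <-> subproj P Q.
Proof.
move=> pQ; split=> [PQ x|PQ _ [x _ <-]].
  by apply/rangeP => //; apply: PQ; exists x.
by rewrite rangeP.
Qed.

(** * The lattice operations and monotone limits in a CSL *)

Context (L : set (H -> H)) (HL : csl dot L).

Lemma L_proj P : L P -> orthogonal_projection dot P.
Proof. by case: HL => + _ _ _ _; apply. Qed.

Lemma L_bop P : L P -> bounded_operator P.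
Proof. by move/L_proj/proj_bop. Qed.

Lemma L_cst0 : L (cst 0).
Proof. by case: HL => _ [+ _]. Qed.

Lemma L_id : L id.
Proof. by case: HL => _ [_ +]. Qed.

Lemma LC P Q x : L P -> L Q -> P (Q x) = Q (P x).
Proof.
by case: HL => _ _ + _ _ => /[apply] /[apply] /(congr1 (fun f => f x)).
Qed.

Lemma LK P x : L P -> P (P x) = P x.
Proof. by move/L_proj/projK. Qed.

Lemma subproj_l P Q x : L P -> L Q -> subproj P Q -> P (Q x) = P x.
Proof. by move=> LP LQ PQ; rewrite LC. Qed.

Lemma subproj_anti P Q : L P -> L Q -> subproj P Q -> subproj Q P -> P = Q.
Proof. by move=> LP LQ PQ QP; apply/funext => x; rewrite -PQ LC. Qed.

Lemma L_meet P Q : L P -> L Q -> L (P \o Q).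
Proof.
move=> LP LQ; have pP := L_proj LP; have pQ := L_proj LQ.
case: HL => _ _ _ /(_ _ _ LP LQ)[[E LE rE] _] _.
suff -> : P \o Q = E by [].
apply: proj_eq; [|exact: L_proj|].
  apply: mk_proj => [a x y /=|x /=|x y /=].
  - by rewrite (bopZD _ _ _ (L_bop LQ)) (bopZD _ _ _ (L_bop LP)).
  - by rewrite -(LC _ LP LQ) !LK // (LC _ LP LQ) LK.
  - by rewrite !proj_dot // LC.
rewrite rE; apply/seteqP; split=> [_ [x _ <-]|x [/(rangeP _ pP) Px /(rangeP _ pQ) Qx]].
  by split; [exists (Q x)| exists (P x); rewrite //= LC].
by exists x => //=; rewrite Qx.
Qed.

(** The commuting projections P and Q have a join whose range is the plain sum
    of the two ranges; in particular this sum is closed. *)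
Definition proj_join P Q : H -> H := fun x => P x + Q x - P (Q x).

Lemma proj_joinP P Q : L P -> L Q -> orthogonal_projection dot (proj_join P Q).
Proof.
move=> LP LQ; have bP := L_bop LP; have bQ := L_bop LQ; rewrite /proj_join.
apply: mk_proj => [a x y /=|x /=|x y /=].
- rewrite !(bopZD _ _ _ bQ) !(bopZD _ _ _ bP) scalerBr scalerDr.
  by rewrite [X in X - _]addrACA opprD [LHS]addrACA.
- have PJ : P (P x + Q x - P (Q x)) = P x.
    by rewrite (bopB _ _ bP) (bopD _ _ bP) !LK // addrK.
  have QJ : Q (P x + Q x - P (Q x)) = Q x.
    by rewrite (bopB _ _ bQ) (bopD _ _ bQ) -!(LC _ LP LQ) !LK // addrAC subrr add0r.
  by rewrite PJ QJ.
- rewrite linearBl linearDl linearBr linearDr /= !proj_dot; try exact: L_proj.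
  by rewrite (LC _ LP LQ).
Qed.

Lemma join_l P Q : L P -> L Q -> subproj P (proj_join P Q).
Proof. by move=> LP LQ x; rewrite /proj_join LK // -(LC _ LP LQ) LK // addrK. Qed.

Lemma join_r P Q : L P -> L Q -> subproj Q (proj_join P Q).
Proof. by move=> LP LQ x; rewrite /proj_join LK // addrAC subrr add0r. Qed.

Lemma join_le P Q E : L P -> L Q -> L E ->
  subproj P E -> subproj Q E -> subproj (proj_join P Q) E.
Proof.
move=> LP LQ LE PE QE x.
by rewrite /proj_join (bopB _ _ (L_bop LE)) (bopD _ _ (L_bop LE)) !PE QE.
Qed.

Lemma L_join P Q : L P -> L Q -> L (proj_join P Q).
Proof.
move=> LP LQ; have pJ := proj_joinP LP LQ.
have pP := L_proj LP; have pQ := L_proj LQ.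
case: HL => _ _ _ /(_ _ _ LP LQ)[_ [E LE rE]] _.
suff -> : proj_join P Q = E by [].
apply: proj_eq; [by []|exact: L_proj|].
rewrite rE; apply/seteqP; split=> [_ [x _ <-]|x].
  apply: subset_closure; exists (P x); first by exists x.
  exists (Q x - P (Q x)); last by rewrite addrA.
  by exists (x - P x) => //; rewrite (bopB _ _ (L_bop LQ)) (LC _ LP LQ).
have /closure_id -> := proj_closed pJ.
apply: closure_subset => _ [_ [u _ <-]] [_ [v _ <-] <-].
apply/rangeP => //.
by rewrite (bopD _ _ (proj_bop pJ)) join_l // join_r.
Qed.

(** A net of projections that is monotone for r converges strongly: at each x
    it is Cauchy because |Q x - P x|^2 is controlled by the increments of a
    bounded monotone quantity phi x.  Taking r and phi as parameters covers
    increasing nets (phi x P = |P x|^2) and decreasing nets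
    (phi x P = - |P x|^2) at once.  Convergence is stated as approximation of
    the limit beyond any given member of the net. *)
Lemma strong_limit (D : set (H -> H)) (r : (H -> H) -> (H -> H) -> Prop)
    (phi : H -> (H -> H) -> R) (b : H -> R) :
    D `<=` L -> D !=set0 -> (forall P Q E, r P Q -> r Q E -> r P E) ->
    (forall P Q, D P -> D Q -> exists E, [/\ D E, r P E & r Q E]) ->
    (forall x P, D P -> phi x P <= b x) ->
    (forall x P Q, D P -> D Q -> r P Q ->
       nrm (Q x - P x) ^+ 2 <= phi x Q - phi x P) ->
  exists2 N, L N & forall x (e : R) P, D P -> 0 < e ->
    exists Q, [/\ D Q, r P Q & nrm (N x - Q x) < e].
Proof.
move=> DL [P0 DP0] rtr dir bnd mono.
pose F : set_system (H -> H) :=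
  [set A | exists2 P, D P & forall Q, D Q -> r P Q -> A Q].
have FF : ProperFilter F.
  split.
    by case=> P DP hP; have [E [DE PE _]] := dir _ _ DP DP; exact: hP DE PE.
  split.
  - by exists P0.
  - move=> A B [P DP PA] [Q DQ QB]; have [E [DE PE QE]] := dir _ _ DP DQ.
    by exists E => // S DS ES; split; [apply: PA|apply: QB] => //; exact: rtr ES.
  - by move=> A B AB [P DP PA]; exists P => // Q DQ PQ; apply: AB; exact: PA.
(* The sections of the net form a filter; a member of the net at which phi x is
   within e^2 of its supremum bounds the oscillation beyond it by e. *)
have cau x : cvg ((fun Q : H -> H => Q x) @ F).
  apply: cvg_nrm => e e0.
  have hs : has_sup [set phi x P | P in D].
    split; first by exists (phi x P0), P0.
    by exists (b x) => _ [P DP <-]; exact: bnd.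
  have [|_ [P DP <-] hP] := @sup_adherent _ _ (e ^+ 2) _ hs.
    by rewrite exprn_gt0.
  exists (P x); exists P => // Q DQ PQ /=.
  rewrite nrm_distC -ltr_sqr ?nnegrE ?nrm_ge0 ?ltW //.
  have := mono x _ _ DP DQ PQ.
  have : phi x Q <= sup [set phi x P | P in D].
    by apply: sup_upper_bound => //; exists Q.
  by move: hP; lra.
pose N x := lim ((fun Q : H -> H => Q x) @ F).
have NF x : (fun Q : H -> H => Q x) @ F --> N x by exact: cau.
have app x (e : R) P : D P -> 0 < e -> exists Q, [/\ D Q, r P Q & nrm (N x - Q x) < e].
  move=> DP e0; have [|S DS hS] := NF x [set y | nrm (N x - y) < e].
    by apply/nbhs_nrm; exists e.
  by have [E [DE PE SE]] := dir _ _ DP DS; exists E; split=> //; exact: hS.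
exists N => //.
have FL : F L by exists P0 => // Q /DL.
have bN : bounded_operator N.
  apply: (mk_bop (c := 1)) => [a x y|x].
    apply: (@cvg_unique _ (@norm_hausdorff _ H)
      ((fun Q : H -> H => Q (a *: x + y)) @ F)).
      exact: NF.
    have lim_lin := cvgD (cvgZl_tmp (k := a) (NF x)) (NF y).
    move=> A /lim_lin hA.
    have : F (L `&` [set Q | A (a *: Q x + Q y)]) by exact: filterI.
    by apply: filterS => Q [LQ] /=; rewrite bopZD //; exact: L_bop.
  rewrite mul1r leNgt; apply/negP => h.
  have [|Q [DQ _ hQ]] := app x (nrm (N x) - nrm x) P0 DP0; first by rewrite subr_gt0.
  have := nrmD (N x - Q x) (Q x); rewrite subrK.
  have := proj_nrm x (L_proj (DL _ DQ)); lra.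
case: HL => _ _ _ _; apply => //.
rewrite closureEcvg; exists F => //; split; last by move=> A LA; apply: filterS FL.
by apply/pointwise_cvgP => x; exact: NF.
Qed.

Lemma subproj_refl P : L P -> subproj P P.
Proof. by move=> LP x; rewrite LK. Qed.

Lemma subproj_trans P Q E : subproj P Q -> subproj Q E -> subproj P E.
Proof. by move=> PQ QE x; rewrite -[P x]PQ QE. Qed.

Lemma fix_closed P z : L P ->
  (forall e : R, 0 < e -> exists2 y, P y = y & nrm (z - y) < e) -> P z = z.
Proof.
move=> /L_proj pP h; apply/rangeP => //; apply: (proj_closed pP).
by apply/closure_nrm => e /h[y /(rangeP _ pP) Py zy]; exists y.
Qed.

Lemma nrm_subproj P Q x : L P -> L Q -> subproj P Q ->
  nrm (Q x - P x) ^+ 2 = nrm (Q x) ^+ 2 - nrm (P x) ^+ 2.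
Proof.
move=> LP LQ PQ; rewrite (proj_pythagoras (Q x) (L_proj LP)).
by rewrite (subproj_l _ LP LQ PQ) addrAC subrr add0r.
Qed.

(** Since L is closed under meets, the elements of L containing S form a
    decreasing net; its limit is the smallest element of L containing S.  This
    is E(A) when S is the range of A. *)
Lemma hull (S : set H) : exists N, [/\ L N, forall x, S x -> N x = x &
  forall Q, L Q -> (forall x, S x -> Q x = x) -> subproj N Q].
Proof.
pose D : set (H -> H) := [set Q | L Q /\ forall x, S x -> Q x = x].
have DI : D id by split=> //; exact: L_id.
have [|||||| N LN app] := @strong_limit D (fun P Q => subproj Q P)
    (fun x P => - nrm (P x) ^+ 2) (fun=> 0).
- by move=> Q [].
- by exists id.
- by move=> P Q E QP EQ; exact: subproj_trans EQ QP.
- move=> P Q [LP PS] [LQ QS]; exists (P \o Q); split.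
  + by split=> [|x Sx /=]; [exact: L_meet | rewrite QS ?PS].
  + by move=> x /=; rewrite LK.
  + by move=> x /=; rewrite (LC _ LQ LP) LK.
- by move=> x P _; rewrite oppr_le0 sqr_ge0.
- move=> x P Q [LP _] [LQ _] QP.
  by rewrite -nrmN opprB nrm_subproj // opprK addrC.
exists N; split=> // [x Sx|Q LQ QS x].
  apply: nrm_small => e e0; have [Q [[_ QS] _]] := app x e _ DI e0.
  by rewrite QS.
apply: fix_closed => // e e0.
have [E [[LE _] EQ xE]] := app x e Q (conj LQ QS) e0.
by exists (E x).
Qed.

Lemma chain_sup (C : set (H -> H)) : C `<=` L -> C !=set0 ->
  (forall P Q, C P -> C Q -> subproj P Q \/ subproj Q P) ->
  exists N, [/\ L N, forall Q, C Q -> subproj Q N & forall x (e : R), 0 < e ->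
    exists2 Q, C Q & nrm (N x - Q x) < e].
Proof.
move=> CL C0 tot.
have [||||N LN app] := @strong_limit C subproj
    (fun x P => nrm (P x) ^+ 2) (fun x => nrm x ^+ 2) CL C0.
- exact: subproj_trans.
- move=> P Q CP CQ; have [PQ|QP] := tot _ _ CP CQ.
    by exists Q; split=> //; apply: subproj_refl; exact: CL.
  by exists P; split=> //; apply: subproj_refl; exact: CL.
- by move=> x P /CL/L_proj/proj_nrm h; rewrite lerXn2r ?nnegrE ?nrm_ge0.
- by move=> x P Q /CL LP /CL LQ PQ; rewrite nrm_subproj.
exists N; split=> // [Q CQ x|x e e0].
  apply: nrm_small => e e0.
  by have [E [CE QE]] := app (Q x) e Q CQ e0; rewrite QE.
by case: C0 => P CP; have [Q [CQ _ xQ]] := app x e P CP e0; exists Q.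
Qed.

(** * Atoms *)

Lemma interval_proj E F : L E -> L F -> subproj F E ->
  orthogonal_projection dot (E \- F).
Proof.
move=> LE LF FE; have bE := L_bop LE; have bF := L_bop LF.
apply: mk_proj => [a x y /=|x /=|x y /=].
- by rewrite (bopZD _ _ _ bE) (bopZD _ _ _ bF) opprD addrACA -scalerBr.
- by rewrite (bopB _ _ bE) (bopB _ _ bF) FE (subproj_l _ LF LE FE) !LK // subrr subr0.
- rewrite linearBl linearBr /= (proj_dot _ _ (L_proj LE)).
  by rewrite (proj_dot _ _ (L_proj LF)).
Qed.

Lemma atomP A : atom L A -> exists E F, [/\ L E, L F, subproj F E & A = E \- F].
Proof.
case=> -[E [F [LE LF FE ->]]] _ _; exists E, F; split=> //.
by apply/le_projP => //; exact: L_proj.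
Qed.

Lemma atom_proj A : atom L A -> orthogonal_projection dot A.
Proof. by move=> /atomP[E [F [LE LF FE ->]]]; exact: interval_proj. Qed.

Lemma atomC A Q x : atom L A -> L Q -> Q (A x) = A (Q x).
Proof.
move=> /atomP[E [F [LE LF FE ->]]] LQ /=.
by rewrite (bopB _ _ (L_bop LQ)) (LC _ LQ LE) (LC _ LQ LF).
Qed.

Lemma atom_neq0 A : atom L A -> exists x, A x <> 0.
Proof.
move=> [_ A0 _]; apply: contrapT => h; apply: A0; apply/funext => x.
by apply: contrapT => Ax; apply: h; exists x.
Qed.

(** Q A is again an interval and is contained in A, so by minimality it is
    either A or 0. *)
Lemma atom_dichotomy A Q : atom L A -> L Q -> subproj A Q \/ forall x, Q (A x) = 0.
Proof.
move=> aA LQ; have [E [F [LE LF FE AE]]] := atomP aA.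
have [QA0|QA0] := pselect (Q \o A = cst 0).
  by right=> x; have := congr1 (fun f => f x) QA0.
left; case: (aA) => _ _ /(_ (Q \o A)) minA x.
suff QAA : Q \o A = A by have /= := congr1 (fun f => f x) QAA.
apply: minA => //.
- exists (Q \o E), (Q \o F); split; try exact: L_meet.
    apply/le_projP; first by apply: L_proj; exact: L_meet.
    by move=> y /=; rewrite -(LC _ LQ LE) LK // FE.
  by apply/funext => y; rewrite AE /= (bopB _ _ (L_bop LQ)).
- by move=> _ [y _ <-] /=; exists (Q y) => //; rewrite (atomC _ aA LQ).
Qed.

(** * Operators in Alg L and invariant manifolds *)

Lemma AlgP T : Alg L T <->
  bounded_operator T /\ forall P x, L P -> P x = x -> P (T x) = T x.
Proof.
split=> -[bT TL]; split=> // P.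
  move=> x LP Px; have pP := L_proj LP; apply/rangeP => //.
  by apply: (TL P LP); exists x => //; apply/rangeP.
move=> LP _ [x /(rangeP _ (L_proj LP)) Px <-].
by apply/(rangeP _ (L_proj LP)); exact: TL.
Qed.

Lemma ManP (M : set H) : Man (Alg L) M <->
  [/\ M 0, forall a x y, M x -> M y -> M (a *: x + y) &
      forall T x, Alg L T -> M x -> M (T x)].
Proof.
split=> [[[M0 Ml] MT]|[M0 Ml MT]].
  split=> [|a x y Mx My|T x AT Mx].
  - by have := M0; rewrite inE.
  - by have := Ml a x y; rewrite !inE; apply.
  - by apply: (MT T AT); exists x.
split; first by split=> [|a x y]; rewrite !inE; [|exact: Ml].
by move=> T AT _ [x Mx <-]; exact: MT.
Qed.

Lemma Alg_L P : L P -> Alg L P.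
Proof.
move=> LP; apply/AlgP; split=> [|Q x LQ Qx]; first exact: L_bop.
by rewrite (LC _ LQ LP) Qx.
Qed.

(** A projection Q in L either contains A, hence E and y, or is orthogonal to A,
    in which case the functional vanishes on the range of Q. *)
Lemma Alg_rank_one A E u y : atom L A ->
  (forall Q, L Q -> subproj A Q -> subproj E Q) -> E y = y ->
  Alg L (fun z => dot z (A u) *: y).
Proof.
move=> aA minE Ey; apply/AlgP; split.
  apply: (mk_bop (c := nrm (A u) * nrm y)) => [a x z|x].
    by rewrite linearPl /= scalerDl scalerA.
  rewrite nrmZ mulrAC [_ * nrm x]mulrC ler_wpM2r ?nrm_ge0 //.
  exact: cauchy_schwarz.
move=> Q z LQ Qz; rewrite (bopZ _ _ (L_bop LQ)).
have [/(minE _ LQ) EQ|QA0] := atom_dichotomy aA LQ.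
  by rewrite -{1}Ey EQ Ey.
by rewrite -Qz (proj_dot _ _ (L_proj LQ)) QA0 linear0r !scale0r.
Qed.

(** The operator of [Alg_rank_one] maps u to |A u|^2 y. *)
Lemma atom_in_manifold A (M : set H) u : atom L A -> Man (Alg L) M -> M u ->
  A u <> 0 -> exists E, [/\ L E, subproj A E & range E `<=` M].
Proof.
move=> aA /ManP[M0 Ml MT] Mu Au.
have [E [LE AE minE]] := hull (range A).
have pA := atom_proj aA; exists E; split=> // [x|y /(rangeP _ (L_proj LE)) Ey].
  by apply: AE; exists x.
have rk : Alg L (fun z => dot z (A u) *: y).
  apply: (Alg_rank_one u aA _ Ey) => Q LQ AQ; apply: minE => // _ [x _ <-].
  exact: AQ.
have := Ml (dot u (A u))^-1 _ _ (MT _ _ rk Mu) M0.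
rewrite addr0 scalerA mulVf ?scale1r // -[A u in X in X != 0](projK u pA).
rewrite -(proj_dot _ _ pA) dotE -[0]/(0%:C) (inj_eq (@complexI R)) sqrf_eq0.
by apply/eqP => /nrm_eq0.
Qed.

(** * Invariant manifolds of a hyperatomic lattice *)

Lemma smallestP k (A : 'I_k -> (H -> H)) P : smallest_containing L A P <->
  [/\ L P, forall i, subproj (A i) P &
      forall Q, L Q -> (forall i, subproj (A i) Q) -> subproj P Q].
Proof.
split=> -[LP AP minP].
  split=> // [i|Q LQ AQ]; apply/le_projP; try exact: L_proj.
    exact: AP.
  by apply: minP => // i; apply/le_projP => //; exact: L_proj.
split=> // [i|Q LQ AQ]; apply/le_projP; try exact: L_proj.
  exact: AP.
by apply: minP => // i; apply/le_projP => //; exact: L_proj.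
Qed.

(** Among the representations P = E(A_1, ..., A_k) the one with k minimal has
    no atom contained in the projection Q generated by the others, so A_i is
    orthogonal to Q.  Writing A_i = E - F, the join of Q and F is orthogonal to
    A_i, and it contains every vector of P killed by A_i because P is contained
    in the join of Q and E. *)
Lemma irredundant_atoms P : hyperatomic_proj L P ->
  exists k (A : 'I_k -> (H -> H)), [/\ forall i, atom L (A i),
    smallest_containing L A P &
    forall i, exists G, [/\ L G, forall x, G (A i x) = 0 &
      forall x, P x = x -> A i x = 0 -> G x = x]].
Proof.
move=> hP; pose p k := `[< exists A : 'I_k -> (H -> H),
  (forall i, atom L (A i)) /\ smallest_containing L A P >].
have exp : exists k, p k by case: hP => k hk; exists k; apply/asboolP.
case: (ex_minnP exp) => k /asboolP[A [aA sA]] mink.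
exists k, A; split=> // i.
have [LP AP minP] := (smallestP A P).1 sA.
case: k A aA sA mink i LP AP minP => [|k] A aA sA mink i LP AP minP.
  by case: i.
have [Q [LQ AQ minQ]] := hull [set y | exists j, range (A (lift i j)) y].
have {}AQ j : subproj (A (lift i j)) Q by move=> x; apply: AQ; exists j, x.
have [AiQ|QAi] := atom_dichotomy (aA i) LQ.
  have /mink : p k; last by rewrite ltnn.
  apply/asboolP; exists (A \o lift i); split=> [j|]; first exact: aA.
  apply/smallestP; split=> // [j|F LF AF]; first exact: AP.
  apply: minP => // m; have [j ->|->] := unliftP i m; first exact: AF.
  apply: subproj_trans AiQ _; apply: minQ => // _ [j [x _ <-]]; exact: AF.
have [E [F [LE LF FE AE]]] := atomP (aA i).
exists (proj_join Q F); split=> [|x|x Px Ax]; first exact: L_join.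
  have FA : F (A i x) = 0.
    by rewrite AE /= (bopB _ _ (L_bop LF)) (subproj_l _ LF LE FE) LK // subrr.
  by rewrite /proj_join QAi FA (bop0 (L_bop LQ)) addr0 subr0.
have EF : E x = F x by move: Ax; rewrite AE => /subr0_eq.
have PJ : subproj P (proj_join Q E).
  apply: minP => [|m]; first exact: L_join.
  have [j ->|->] := unliftP i m; first exact: subproj_trans (join_l LQ LE).
  apply: subproj_trans (join_r LQ LE) => y.
  by rewrite AE /= (bopB _ _ (L_bop LE)) FE LK.
by have := PJ x; rewrite Px /proj_join EF.
Qed.

(** If P is the smallest element of L containing M, no atom of an irredundant
    family generating P vanishes on M: otherwise M would lie in an element of L
    orthogonal to that atom. *)
Lemma Man_sub_range (M : set H) P : Man (Alg L) M -> hyperatomic_proj L P ->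
  (forall G, L G -> (forall x, M x -> G x = x) -> subproj P G) ->
  (forall x, M x -> P x = x) -> range P `<=` M.
Proof.
move=> manM /irredundant_atoms[k [A [aA /smallestP[LP AP minP] irr]]] minM MP.
have hE i : exists E, [/\ L E, subproj (A i) E & range E `<=` M].
  have [[u [Mu Au]]|h] := pselect (exists u, M u /\ A i u <> 0).
    exact: (atom_in_manifold (aA i) manM Mu Au).
  have [G [LG GA GP]] := irr i; have [x Ax] := atom_neq0 (aA i).
  case: Ax; rewrite -(AP i x) -(minM _ LG); first by rewrite (AP i x) GA.
  move=> y My; apply: GP; first exact: MP.
  by apply: contrapT => Ay; apply: h; exists y.
have [M0 Ml _] := (ManP M).1 manM.
have MD x y : M x -> M y -> M (x + y).
  by move=> Mx; have := Ml 1 x y Mx; rewrite scale1r.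
have join_s (s : seq 'I_k) : exists E,
    [/\ L E, forall i, i \in s -> subproj (A i) E & range E `<=` M].
  elim: s => [|i s [E [LE AE EM]]].
    by exists (cst 0); split=> //; [exact: L_cst0 | move=> _ [x _ <-]].
  have [F [LF AF FM]] := hE i.
  exists (proj_join F E); split=> [|j|]; first exact: L_join.
    rewrite inE => /predU1P[->|js]; first exact: subproj_trans (join_l LF LE).
    exact: subproj_trans (AE j js) (join_r LF LE).
  move=> _ [x _ <-]; rewrite /proj_join -addrA; apply: MD; first by apply: FM; exists x.
  apply: EM; exists (x - F x) => //.
  by rewrite (bopB _ _ (L_bop LE)) (LC _ LF LE).
have [E [LE AE EM]] := join_s (enum 'I_k).
have PE : subproj P E by apply: minP => // i; apply: AE; rewrite mem_enum.
by move=> _ [x _ <-]; apply: EM; exists (P x).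
Qed.

Lemma Man_range_hyperatomic (M : set H) : hyperatomic L -> Man (Alg L) M ->
  exists2 P, L P & M = range P.
Proof.
move=> hL manM; have [P [LP MP minP]] := hull M.
have pP := L_proj LP; exists P => //; apply/seteqP; split=> [x Mx|].
  by apply/rangeP => //; exact: MP.
have [P0|P0] := pselect (P = cst 0); last exact: Man_sub_range (hL _ LP P0) _ MP.
by rewrite P0 => _ [x _ <-]; have [] := (ManP M).1 manM.
Qed.

Lemma range_Man P : L P -> Man (Alg L) (range P).
Proof.
move=> LP; have pP := L_proj LP; have bP := L_bop LP.
apply/ManP; split=> [|a x y /(rangeP _ pP) Px /(rangeP _ pP) Py|
    T x /AlgP[bT TL] /(rangeP _ pP) Px]; apply/rangeP => //.
- exact: bop0.
- by rewrite bopZD // Px Py.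
- exact: TL.
Qed.

Lemma cyclic_Man x : Man (Alg L) (cyclic_manifold (Alg L) x).
Proof.
apply/ManP; split.
- by exists (cst 0) => //; apply: Alg_L; exact: L_cst0.
- move=> a _ _ [S /AlgP[bS SL] <-] [T /AlgP[bT TL] <-].
  exists (fun z => a *: S z + T z) => //; apply/AlgP; split.
    have [c c0 Sc] := bop_bound bS; have [d d0 Td] := bop_bound bT.
    apply: (mk_bop (c := complex.Re `|a| * c + d)) => [b y z|y].
      rewrite (bopZD _ _ _ bS) (bopZD _ _ _ bT) [in LHS]scalerDr.
      by rewrite [LHS]addrACA [in RHS]scalerDr !scalerA [a * b]mulrC.
    rewrite (le_trans (nrmD _ _)) // nrmZ mulrDl lerD // -mulrA ler_wpM2l //.
    by rewrite -ler0c Re_normK.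
  by move=> P z LP Pz; rewrite (bopZD _ _ _ (L_bop LP)) (SL P z) // (TL P z).
- move=> S _ /AlgP[bS SL] [T /AlgP[bT TL] <-]; exists (S \o T) => //.
  apply/AlgP; split=> [|P z LP Pz /=]; last by rewrite (SL P (T z)) // (TL P z).
  have [c c0 Sc] := bop_bound bS; have [d d0 Td] := bop_bound bT.
  apply: (mk_bop (c := c * d)) => [b y z|y] /=.
    by rewrite (bopZD _ _ _ bT) (bopZD _ _ _ bS).
  by rewrite (le_trans (Sc _)) // -mulrA ler_wpM2l.
Qed.

Lemma cyclic_self x : cyclic_manifold (Alg L) x x.
Proof. by exists id => //; apply: Alg_L; exact: L_id. Qed.

(** * Vectors on which countably many atoms do not vanish *)

(** 0 is generated by the empty family of atoms. *)
Lemma hyperatomic_proj0 : hyperatomic_proj L (cst 0).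
Proof.
exists 0%N, (fun _ => cst 0); split; first by case.
apply/smallestP; split=> [|[]//|Q LQ _ x]; first exact: L_cst0.
exact: bop0 (L_bop LQ).
Qed.

Lemma half_pow_small (e : R) : 0 < e -> exists N, (2^-1 : R) ^+ N < e.
Proof.
move=> e0; exists (Num.bound e^-1).
have h : e^-1 < (Num.bound e^-1)%:R by rewrite archi_boundP // invr_ge0 ltW.
have h2 : e^-1 < 2 ^+ (Num.bound e^-1).
  by apply: lt_trans h _; rewrite -natrX ltr_nat ltn_expl.
rewrite exprVn -[ltLHS]mul1r ltr_pdivrMr ?exprn_gt0 //.
by rewrite -ltr_pdivrMl // mulr1.
Qed.

Lemma series_half_pow (u : nat -> H) :
  (forall n, nrm (u n) <= 2^-1 ^+ n) ->
  exists y, forall e : R, 0 < e -> exists N, forall n, (N <= n)%N ->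
    nrm (y - \sum_(i < n) u i) < e.
Proof.
move=> hu; pose s n := \sum_(i < n) u i.
have tail m n : (m <= n)%N -> nrm (s m - s n) <= 2 * 2^-1 ^+ m - 2 * 2^-1 ^+ n.
  move=> /subnKC <-; elim: (n - m)%N => [|d IHd].
    by rewrite addn0 !subrr nrm0.
  rewrite addnS /s big_ord_recr /= -/(s (m + d)%N) opprD addrA.
  apply: le_trans (nrmB _ _) _.
  by have := hu (m + d)%N; rewrite exprS; move: IHd => h h2; lra.
have cs : cvg (s @ \oo).
  apply: cvg_nrm => e e0.
  have [|m hm] := @half_pow_small (e / 2); first by rewrite divr_gt0.
  exists (s m); exists m => // n /= mn.
  have := tail _ _ mn; have : 0 <= (2^-1 : R) ^+ n by rewrite exprn_ge0 // invr_ge0.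
  by lra.
exists (lim (s @ \oo)) => e e0.
have /(_ [set y | nrm (lim (s @ \oo) - y) < e])[] : s @ \oo --> lim (s @ \oo) by [].
  by apply/nbhs_nrm; exists e.
by move=> N _ hN; exists N => n Nn; exact: hN.
Qed.

(** With A = E - F, if B were inside E and orthogonal to F it would be inside
    A, hence equal to A by minimality. *)
Lemma atom_orth A B x : atom L A -> atom L B -> A <> B -> A (B x) = 0.
Proof.
move=> aA aB AB; have [E [F [LE LF FE AE]]] := atomP aA.
have [BE|BE] := atom_dichotomy aB LE; last first.
  by rewrite AE /= -[F (B x)](subproj_l _ LF LE FE) BE (bop0 (L_bop LF)) subrr.
have [BF|BF] := atom_dichotomy aB LF; first by rewrite AE /= BE BF subrr.
have ABE y : A (B y) = B y by rewrite AE /= BE BF subr0.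
case: AB; case: aA => _ _ minA; apply/esym; apply: minA.
- by case: aB.
- by case: aB.
- by move=> _ [y _ <-]; exists (B y).
Qed.

(** The vector is the sum of 2^-n f(A_n), where f picks a unit vector in each
    atom.  Because f depends on the atom and not on its index, an atom repeated
    in the family contributes positive multiples of the same vector, and
    distinct atoms are orthogonal; so no cancellation occurs. *)
Lemma generic_vector (I : countType) (A : I -> (H -> H)) :
  (forall i, atom L (A i)) -> exists x, forall i, A i x <> 0.
Proof.
move=> aA.
have /choice[f hf] (B : H -> H) : exists v, atom L B -> B v = v /\ nrm v = 1.
  have [aB|] := pselect (atom L B); last by exists 0.
  have [v Bv] := atom_neq0 aB; have pB := atom_proj aB.
  have nv : 0 < nrm (B v).
    by rewrite lt_neqAle nrm_ge0 andbT; apply/eqP => /esym/nrm_eq0.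
  exists ((nrm (B v))^-1%:C *: B v) => _.
  rewrite (bopZ _ _ (proj_bop pB)) projK // nrmZr ?invr_ge0 ?nrm_ge0 //.
  by rewrite mulVf // gt_eqF.
(* w i n is the coefficient of f (A i) contributed by the n-th term u n. *)
pose w i n : R := if unpickle n is Some j then
  (if `[< A j = A i >] then 2^-1 ^+ n else 0) else 0.
pose u n : H := if unpickle n is Some j then (2^-1 ^+ n)%:C *: f (A j) else 0.
have p0 n : 0 <= (2^-1 : R) ^+ n by rewrite exprn_ge0 // invr_ge0.
have w0 i n : 0 <= w i n by rewrite /w; case: unpickle => // j; case: ifP.
have [|x hx] := @series_half_pow u.
  move=> n; rewrite /u; case: unpickle => [j|]; last by rewrite nrm0.
  by rewrite nrmZr // (hf _ (aA j)).2 mulr1.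
have Au i n : A i (u n) = (w i n)%:C *: f (A i).
  rewrite /u /w; have bA := proj_bop (atom_proj (aA i)).
  case: unpickle => [j|]; last by rewrite scale0r (bop0 bA).
  rewrite (bopZ _ _ bA); case: asboolP => [->|ji]; first by rewrite (hf _ (aA i)).1.
  rewrite -(hf _ (aA j)).1 (atom_orth _ (aA i) (aA j)) ?scaler0 ?scale0r //.
  by move=> ij; apply: ji.
exists x => i Ax; have pA := atom_proj (aA i); have bA := proj_bop pA.
have [|N hN] := hx (2^-1 ^+ pickle i); first by rewrite exprn_gt0 // invr_gt0.
pose n := maxn N (pickle i).+1.
have := hN n (leq_maxl _ _); apply/negP; rewrite -leNgt.
apply: le_trans (proj_nrm _ pA).
rewrite (bopB _ _ bA) Ax sub0r nrmN (bop_sum _ _ _ bA).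
under eq_bigr do rewrite Au.
rewrite -scaler_suml -rmorph_sum nrmZr ?sumr_ge0 // (hf _ (aA i)).2 mulr1.
have lt_n : (pickle i < n)%N by exact: leq_maxr.
rewrite (bigD1 (Ordinal lt_n)) //= {1}/w pickleK asboolT // lerDl.
by rewrite sumr_ge0.
Qed.

(** Take x with A_i x <> 0 for all the generating atoms A_i.  An element of L
    containing P x annihilates no A_i, so it contains all of them; hence P is
    the smallest element of L containing the cyclic manifold of P x. *)
Lemma hyperatomic_cyclic P : L P -> hyperatomic_proj L P ->
  exists2 x, P x = x & cyclic_manifold (Alg L) x = range P.
Proof.
move=> LP hP; have [k [A [aA /smallestP[_ AP minP]]]] := hP.
have [x Ax] := generic_vector aA.
have PPx : P (P x) = P x by rewrite LK.
have cP y : cyclic_manifold (Alg L) (P x) y -> P y = y.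
  by move=> [T /AlgP[_ TL] <-]; exact: TL.
exists (P x) => //; apply/seteqP; split=> [y /cP Py|]; first by exists y.
apply: Man_sub_range hP _ cP; first exact: cyclic_Man.
move=> G LG /(_ _ (cyclic_self (P x))) GPx; apply: minP => // i.
have [//|GA] := atom_dichotomy (aA i) LG.
by case: (Ax i); rewrite -(AP i x) (atomC _ (aA i) LP) -GPx -(atomC _ (aA i) LG) GA.
Qed.

(** * Maximal elements below a projection *)

Definition coatom P Q := [/\ L Q, subproj Q P, Q <> P &
  forall E, L E -> subproj Q E -> subproj E P -> E = Q \/ E = P].

(** The gap c passes to strong limits, so the supremum of a chain of projections
    strictly below P is still different from P and Zorn's lemma applies. *)
Lemma coatom_above P Q0 x (c : R) : L P -> P x = x -> 0 < c ->
  (forall Q, L Q -> subproj Q P -> Q <> P -> c <= nrm (x - Q x)) ->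
  L Q0 -> subproj Q0 P -> Q0 <> P -> exists2 Q, coatom P Q & subproj Q0 Q.
Proof.
move=> LP Px c0 gap LQ0 Q0P nQ0P.
pose T := {Q | [/\ L Q, subproj Q0 Q, subproj Q P & Q <> P]}.
have T0 : T by exists Q0; split=> //; exact: subproj_refl.
have [|||A totA|[Q [LQ Q0Q QP nQP]] maxQ] :=
  @Zorn T (fun s t => `[< subproj (sval s) (sval t) >]).
- by move=> [Q [LQ ? ? ?]]; apply/asboolP => /=; exact: subproj_refl.
- by move=> r s t /asboolP rs /asboolP st; apply/asboolP; exact: subproj_trans rs st.
- move=> [Q hQ] [E hE] /asboolP/= QE /asboolP/= EQ; apply: eq_exist.
  by case: hQ => LQ _ _ _; case: hE => LE _ _ _; exact: subproj_anti.
- have [[s0 As0]|A0] := pselect (A !=set0); last first.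
    by exists T0 => s As; case: A0; exists s.
  pose C : set (H -> H) := [set sval s | s in A].
  have [|||N [LN CN appN]] := @chain_sup C.
  + by move=> _ [[Q [LQ ? ? ?]] _ <-].
  + by exists (sval s0), s0.
  + move=> _ _ [s As <-] [t At <-].
    by have [/asboolP|/asboolP] := totA s t As At; [left|right].
  have Q0N : subproj Q0 N.
    apply: subproj_trans (CN (sval s0) _); last by exists s0.
    by case: (s0) => ? [].
  have NP : subproj N P.
    move=> y; apply: fix_closed => // e /(appN y)[E [[Q [LQ _ QP _]] _ /= QE] yE].
    by exists (E y); rewrite // -QE.
  have nNP : N <> P.
    move=> NeP; have [E [[Q [LQ _ QP nQP]] _ /= <-]] := appN x c c0.
    by rewrite NeP Px ltNge gap.
  exists (exist _ N (And4 LN Q0N NP nNP)) => s As; apply/asboolP => /=.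
  by apply: CN; exists s.
exists Q => //; split=> // E LE QE EP.
have [->|nEP] := pselect (E = P); [by right|left].
have hE : [/\ L E, subproj Q0 E, subproj E P & E <> P].
  by split=> //; exact: subproj_trans QE.
by have /(_ (asboolT QE))/(congr1 sval) := maxQ (exist _ E hE).
Qed.

(** An interval E - F inside P - Q is compared with Q through the joins of Q
    with E P and with F P, both of which lie between Q and P.  The first must be
    P and the second Q, as the other choices make E - F vanish; subtracting
    the two equations gives P - Q = E - F. *)
Lemma coatom_atom P Q : L P -> coatom P Q -> atom L (P \- Q).
Proof.
move=> LP [LQ QP nQP maxQ]; split.
- by exists P, Q; split=> //; apply/le_projP => //; exact: L_proj.
- move=> /(congr1 (fun f => f _)) h; apply: nQP; apply/funext => x.
  by apply/esym/subr0_eq; exact: h.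
move=> _ [E [F [LE LF /(le_projP _ (L_proj LE)) FE ->]]] nEF sub.
have {sub} sub : subproj (E \- F) (P \- Q).
  by apply/le_projP => //; exact: interval_proj.
have bQ := L_bop LQ; have bP := L_bop LP.
have PB x : P (E x - F x) = E x - F x.
  by have := sub x => /= <-; rewrite (bopB _ _ bP) LK // QP.
have QB x : Q (E x - F x) = 0.
  by have := sub x => /= <-; rewrite (bopB _ _ bQ) LK // (subproj_l _ LQ LP QP) subrr.
have EB x : E (E x - F x) = E x - F x by rewrite (bopB _ _ (L_bop LE)) LK // FE.
have FB x : F (E x - F x) = 0.
  by rewrite (bopB _ _ (L_bop LF)) LK // (subproj_l _ LF LE FE) subrr.
have between G : L G -> let J := proj_join Q (G \o P) in J = Q \/ J = P.
  move=> LG J; have LGP := L_meet LG LP; apply: maxQ.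
  - exact: L_join.
  - exact: join_l.
  - by apply: join_le => // x /=; rewrite (LC _ LP LG) LK.
have EJ : proj_join Q (E \o P) = P.
  case: (between E LE) => // JQ; case: nEF; apply/funext => x /=.
  have := congr1 (fun f => f (E x - F x)) JQ.
  by rewrite /proj_join /= PB EB QB add0r subr0.
have FJ : proj_join Q (F \o P) = Q.
  case: (between F LF) => // JP; case: nEF; apply/funext => x /=.
  have := congr1 (fun f => f (E x - F x)) JP.
  by rewrite /proj_join /= PB FB QB (bop0 bQ) addr0 subr0.
apply/funext => x /=.
have /= := congr1 (fun f => f x) EJ; have /= := congr1 (fun f => f x) FJ.
rewrite /proj_join /= => FJx EJx.
have QEF : Q (E (P x)) = Q (F (P x)).
  by apply/subr0_eq; rewrite -(bopB _ _ bQ) QB.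
have EFx : E x - F x = E (P x) - F (P x).
  by rewrite -PB (bopB _ _ bP) (LC _ LP LE) (LC _ LP LF).
have -> : P x - Q x = (Q x + E (P x) - Q (E (P x))) - (Q x + F (P x) - Q (F (P x))).
  by rewrite EJx FJx.
by rewrite EFx QEF opprB subrKA opprD addrACA subrr add0r.
Qed.

Lemma coatom_join P Q Q' : L P -> coatom P Q -> coatom P Q' -> Q <> Q' ->
  proj_join Q Q' = P.
Proof.
move=> LP [LQ QP nQP maxQ] [LQ' Q'P nQ'P maxQ'] nQQ'.
have [JQ|//] := maxQ _ (L_join LQ LQ') (join_l LQ LQ') (join_le LQ LQ' LP QP Q'P).
have Q'Q : subproj Q' Q by have := join_r LQ LQ'; rewrite JQ.
by case: (maxQ' _ LQ Q'Q QP).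
Qed.

(** Let W be the meet of the coatoms in s.  Meeting W with one more coatom Q
    removes exactly (P - Q) x from W x, because P - Q is orthogonal to the
    atoms P - E with E in s; so each coatom lowers |W x|^2 by at least c^2. *)
Lemma coatoms_bounded P x (c : R) (s : seq (H -> H)) : L P -> P x = x ->
  0 <= c ->
  (forall Q, L Q -> subproj Q P -> Q <> P -> c <= nrm (x - Q x)) ->
  uniq s -> (forall Q, Q \in s -> coatom P Q) ->
  (size s)%:R * c ^+ 2 <= nrm x ^+ 2.
Proof.
move=> LP Px c0 gap us cs.
suff [W [LW [hW _]]] : exists W, L W /\
    ((size s)%:R * c ^+ 2 + nrm (W x) ^+ 2 <= nrm x ^+ 2 /\
    forall Q, coatom P Q -> Q \notin s -> forall y, W (P y - Q y) = P y - Q y).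
  by apply: le_trans hW; rewrite lerDl sqr_ge0.
elim: s us cs => [_ _|Q s IHs /= /andP[Qs us] cs].
  by exists id; split; [exact: L_id | split=> //; rewrite mul0r add0r].
have [||W [LW [hW fixW]]] := IHs; first by [].
  by move=> E Es; apply: cs; rewrite inE Es orbT.
have cQ : coatom P Q by apply: cs; rewrite mem_head.
have [LQ QP nQP _] := cQ.
exists (Q \o W); split; first exact: L_meet; split=> [|E cE]; last first.
  rewrite inE negb_or => /andP[/eqP EQ Es] y /=; rewrite fixW //.
  have [LE EP _ _] := cE.
  have JP : P y = Q y + E y - Q (E y).
    have QE : Q <> E by move=> h; apply: EQ.
    by rewrite -[LHS](congr1 (fun f => f y) (coatom_join LP cQ cE QE)).
  suff -> : P y - E y = Q (y - E y) by rewrite LK.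
  by rewrite JP (bopB _ _ (L_bop LQ)) addrAC addrK.
have QWW : subproj (Q \o W) W by move=> y /=; rewrite (LC _ LW LQ) LK.
have /= := nrm_subproj x (L_meet LQ LW) LW QWW.
have -> : W x - Q (W x) = x - Q x.
  by rewrite -(LC _ LW LQ) -(bopB _ _ (L_bop LW)) -{1 3}Px fixW.
move=> e; have := gap _ LQ QP nQP => g.
have : c ^+ 2 <= nrm (x - Q x) ^+ 2 by rewrite lerXn2r ?nnegrE ?nrm_ge0.
by rewrite e -natr1; lra.
Qed.

(** The atoms P - Q, for Q a coatom, generate P: an F in L containing all of
    them but not P would have F P below some coatom Q, and then the nonzero
    atom P - Q would be inside Q. *)
Lemma gap_hyperatomic P x (c : R) : L P -> P x = x -> 0 < c ->
  (forall Q, L Q -> subproj Q P -> Q <> P -> c <= nrm (x - Q x)) ->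
  hyperatomic_proj L P.
Proof.
move=> LP Px c0 gap.
pose p n := `[< exists s : seq (H -> H), [/\ uniq s, forall Q, Q \in s -> coatom P Q &
  size s = n] >].
have p0 : exists n, p n by exists 0%N; apply/asboolP; exists [::].
have pb n : p n -> (n <= Num.bound (nrm x ^+ 2 / c ^+ 2))%N.
  move=> /asboolP[s [us cs <-]]; rewrite -(ler_nat R) ltW //.
  apply: le_lt_trans (archi_boundP _); last by rewrite divr_ge0 ?sqr_ge0.
  rewrite ler_pdivlMr ?exprn_gt0 //; exact: (coatoms_bounded LP Px (ltW c0) gap us cs).
(* A longest duplicate-free list of coatoms contains all of them. *)
case: (ex_maxnP p0 pb) => n /asboolP[s [us cs sn]] longest.
have all_s Q : coatom P Q -> Q \in s.
  move=> cQ; apply/negP => /negP Qs.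
  suff /longest : p n.+1 by rewrite ltnn.
  apply/asboolP; exists (Q :: s); split; rewrite /= ?Qs ?sn // => E.
  by rewrite inE => /predU1P[->|/cs].
have ci (i : 'I_(size s)) : coatom P (nth id s i) by apply/cs/mem_nth.
exists (size s), (fun i => P \- nth id s i); split=> [i|]; first exact: coatom_atom.
apply/smallestP; split=> // [i y|F LF AF].
  by have [_ QP _ _] := ci i; rewrite /= (bopB _ _ (L_bop LP)) LK // QP.
have [FP y|nFP] := pselect (F \o P = P); first exact: (congr1 (fun f => f y) FP).
have [|Q cQ FQ] := coatom_above LP Px c0 gap (L_meet LF LP) _ nFP.
  by move=> y /=; rewrite (LC _ LP LF) LK.
have [LQ QP nQP _] := cQ; case: nQP; apply/esym/funext => y; apply/subr0_eq.
have sQ : (index Q s < size s)%N by rewrite index_mem all_s.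
have := AF (Ordinal sQ) y; rewrite /= nth_index ?all_s // => FB.
have PB : P (P y - Q y) = P y - Q y by rewrite (bopB _ _ (L_bop LP)) LK // QP.
have := FQ (P y - Q y); rewrite /= PB FB => <-.
by rewrite (bopB _ _ (L_bop LQ)) LK // (subproj_l _ LQ LP QP) subrr.
Qed.

(** * Closed cyclic manifolds *)

(** Without a gap, a series with terms 2^m (x - Q_m x) would produce a vector
    of the cyclic manifold that no bounded operator of Alg L can reach from x. *)
Lemma closed_cyclic_hyperatomic P x : L P -> P x = x ->
  (forall Q, L Q -> Q x = x -> subproj P Q) ->
  closed (cyclic_manifold (Alg L) x) -> hyperatomic_proj L P.
Proof.
move=> LP Px genx closx.
have [[c [c0 gap]]|ngap] := pselect (exists c : R, 0 < c /\
    forall Q, L Q -> subproj Q P -> Q <> P -> c <= nrm (x - Q x)).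
  exact: gap_hyperatomic gap.
exfalso.
(* The rate 4^-n makes the series with weights 2^n converge geometrically. *)
have /choice[Q hQ] n : exists Q, [/\ L Q, subproj Q P, Q <> P &
    nrm (x - Q x) < 4^-1 ^+ n].
  apply: contrapT => h; apply: ngap; exists (4^-1 ^+ n).
  split=> [|Q LQ QP nQP]; first by rewrite exprn_gt0 // invr_gt0.
  by rewrite leNgt; apply/negP => lt; apply: h; exists Q.
have LQ n : L (Q n) by case: (hQ n).
pose E n : H -> H := id \- Q n.
have pE n : orthogonal_projection dot (E n).
  by apply: interval_proj; [exact: L_id | exact: LQ | move=> ?].
have bE n := proj_bop (pE n).
have EC m n z : E m (E n z) = E n (E m z).
  rewrite /E /= (bopB _ _ (L_bop (LQ m))) (bopB _ _ (L_bop (LQ n))).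
  rewrite (LC _ (LQ m) (LQ n)) !opprB !addrA addrAC [RHS]addrAC.
  by congr (_ + _); rewrite -!addrA; congr (_ + _); rewrite addrC.
pose u n : H := (2 ^+ n)%:C *: E n x.
have p2 n : 0 <= (2 : R) ^+ n by rewrite exprn_ge0.
have [|y hy] := @series_half_pow u.
  move=> n; rewrite nrmZr //; case: (hQ n) => _ _ _ /ltW h.
  rewrite (le_trans (ler_wpM2l (p2 n) h)) // -exprMn.
  by rewrite (_ : 2 * 4^-1 = 2^-1 :> R) //; lra.
have [K0 Kl KT] := (ManP _).1 (cyclic_Man x).
have Ks n : cyclic_manifold (Alg L) x (\sum_(i < n) u i).
  elim: n => [|n IHn]; first by rewrite big_ord0.
  rewrite big_ord_recr /= addrC; apply: (Kl) => //.
  have -> : E n x = -1 *: Q n x + x by rewrite scaleN1r addrC.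
  by apply: Kl; [apply: KT; [exact: Alg_L | exact: cyclic_self] | exact: cyclic_self].
have [T /AlgP[bT TL] Ty] : cyclic_manifold (Alg L) x y.
  apply: closx; apply/closure_nrm => e /hy[N hN].
  by exists (\sum_(i < N) u i) => //; exact: hN.
have [C C0 TC] := bop_bound bT.
pose n := Num.bound C.
have Cn : C < 2 ^+ n.
  apply: (@lt_trans _ _ n%:R); first by rewrite archi_boundP.
  by rewrite -natrX ltr_nat ltn_expl.
have r0 : 0 < nrm (E n x).
  rewrite lt_neqAle nrm_ge0 andbT; apply/eqP => /esym/nrm_eq0/subr0_eq/esym Qx.
  have [_ QP nQP _] := hQ n; apply: nQP; apply: subproj_anti => //.
  exact: genx.
have up : nrm (E n y) <= C * nrm (E n x).
  have TQ : E n (T (Q n x)) = 0.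
    by rewrite /E /= (TL (Q n) (Q n x)) ?subrr // LK.
  have -> : E n y = E n (T (E n x)).
    have -> : T (E n x) = T x - T (Q n x) by exact: bopB.
    by rewrite (bopB _ _ (bE n)) TQ subr0 Ty.
  exact: le_trans (proj_nrm _ (pE n)) (TC _).
have low : 2 ^+ n * nrm (E n x) <= nrm (E n y).
  rewrite leNgt; apply/negP => h.
  have [|N hN] := hy (2 ^+ n * nrm (E n x) - nrm (E n y)); first by rewrite subr_gt0.
  pose m := maxn N n.+1.
  have := hN m (leq_maxl _ _); apply/negP; rewrite -leNgt.
  apply: le_trans (proj_nrm _ (pE n)); rewrite (bopB _ _ (bE n)) nrm_distC.
  have := nrmD (E n (\sum_(i < m) u i) - E n y) (E n y); rewrite subrK.
  suff : 2 ^+ n * nrm (E n x) <= nrm (E n (\sum_(i < m) u i)) by lra.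
  have nm : (n < m)%N by exact: leq_maxr.
  rewrite (bop_sum _ _ _ (bE n)) (bigD1 (Ordinal nm)) //= {1}/u.
  rewrite (bopZ _ _ (bE n)) projK // -nrmZr //; apply: nrm_le_add.
  (* <E_n x, E_n E_i x> = |E_i E_n x|^2, since E_i and E_n commute. *)
  rewrite linear_sumr /=; apply: sumr_ge0 => i _.
  rewrite /u (bopZ _ _ (bE n)) linearZl_LR linearZr_LR /= EC.
  rewrite -(projK (E n x) (pE i)) -(proj_dot _ _ (pE i)) dotE.
  by rewrite !mulr_ge0 ?conjC_ge0 ?ler0c ?sqr_ge0.
have := le_trans low up; rewrite ler_pM2r //; lra.
Qed.

(** Let d enumerate a dense set.  The smallest element of L containing P (d n)
    is hyperatomic for each n, and all the atoms so obtained form a countable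
    family inside P.  The smallest N in L containing P x, for x generic with
    respect to this family, contains all these atoms, hence all P (d n), hence
    P; so N = P, and N is hyperatomic. *)
Lemma hyperatomic_of_closed : separable H ->
  (forall x, closed (cyclic_manifold (Alg L) x)) -> hyperatomic L.
Proof.
move=> [D /countable_injP[g ginj] denseD] clos P LP _.
(* Values of n that g does not take on D give d n = 0, which does no harm. *)
pose d n := xget 0 [set v | D v /\ g v = n].
have dD v : D v -> exists n, d n = v.
  move=> Dv; exists (g v); rewrite /d; case: xgetP => [w _ [Dw gw]|/(_ v)[]//].
  by apply: ginj; rewrite ?inE.
have hull_hyperatomic x : exists N, [/\ L N, N x = x, 
    forall Q, L Q -> Q x = x -> subproj N Q & hyperatomic_proj L N].
  have [N [LN Nx minN]] := hull [set x].
  have Nx' := Nx x erefl.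
  have min' Q : L Q -> Q x = x -> subproj N Q by move=> LQ Qx; apply: minN => // _ ->.
  by exists N; split=> //; exact: closed_cyclic_hyperatomic (clos x).
have /choice[f hf] n : exists s : {k & 'I_k -> (H -> H)},
    (forall i, atom L (projT2 s i)) /\
    forall Q, L Q -> (forall i, subproj (projT2 s i) Q) <-> Q (P (d n)) = P (d n).
  have [N [LN Nx minN hypN]] := hull_hyperatomic (P (d n)).
  have [k [A [aA /smallestP[_ AN minA]]]] := hypN.
  exists (existT _ k A); split=> //= Q LQ; split=> [AQ|Qx i].
    by rewrite -Nx (minA Q LQ AQ).
  exact: subproj_trans (AN i) (minN Q LQ Qx).
pose A (i : {n & 'I_(projT1 (f n))}) : H -> H := projT2 (f (tag i)) (tagged i).
have aA i : atom L (A i) by exact: (hf (tag i)).1.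
have [x Ax] := generic_vector aA.
have [N [LN Nx minN hN]] := hull_hyperatomic (P x).
suff <- : N = P by [].
apply: subproj_anti => //; first by apply: minN => //; rewrite LK.
have AP i : subproj (A i) P.
  case: i => n i; have /= [_ /(_ P LP)[_ h]] := hf n; apply: h.
  by rewrite LK.
have AN i : subproj (A i) N.
  have [//|NA] := atom_dichotomy (aA i) LN.
  by case: (Ax i); rewrite -(AP i x) (atomC _ (aA i) LP) -Nx -(atomC _ (aA i) LN) NA.
have Nd n : N (P (d n)) = P (d n).
  have [_ /(_ N LN)[h _]] := hf n; apply: h => i.
  exact: (AN (Tagged (fun n => 'I_(projT1 (f n))) i)).
move=> y; apply: fix_closed => // e e0.
have [||v [yv /dD[n dn]]] := denseD [set v | nrm (y - v) < e].
- by exists y => /=; rewrite subrr nrm0.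
- rewrite openE => v /= yv; apply/nbhs_nrm.
  exists (e - nrm (y - v)); first by rewrite subr_gt0.
  move=> w vw /=; rewrite -(subrKA v) (le_lt_trans (nrmD _ _)) //.
  by move: vw; rewrite ltrBrDl.
exists (P v); first by rewrite -dn.
by rewrite -(bopB _ _ (L_bop LP)) (le_lt_trans (proj_nrm _ (L_proj LP))).
Qed.

End HilbertLattice.

(** * The equivalence *)

Theorem theorem4 (R : realType) (H : completeNormedModType R[i])
    (dot : {dot H for Num.conj}) (Hdot : hilbert_norm dot)
    (Hsep : separable H) (L : set (H -> H)) (HL : csl dot L) :
  [<-> hyperatomic L;
       forall M : set H, Man (Alg L) M -> closed M;
       Man (Alg L) = [set range P | P in L];
       forall M : set H, Man (Alg L) M -> singly_generated (Alg L) M ->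
         closed M;
       forall P, L P -> exists2 x, range P x & cyclic_manifold (Alg L) x = range P;
       forall M : set H, Man (Alg L) M -> singly_generated (Alg L) M].
Proof.
have hyp0 : hyperatomic L -> forall P, L P -> hyperatomic_proj L P.
  move=> hL P LP; have [->|P0] := pselect (P = cst 0); last exact: hL.
  exact: (hyperatomic_proj0 HL).
have Man_range : hyperatomic L -> Man (Alg L) = [set range P | P in L].
  move=> hL; apply/seteqP; split=> [M manM|_ [P LP <-]]; last exact: (range_Man HL LP).
  by have [P LP ->] := Man_range_hyperatomic Hdot HL hL manM; exists P.
have range_closed : Man (Alg L) = [set range P | P in L] ->
    forall M : set H, Man (Alg L) M -> closed M.
  by move=> -> M [P LP <-]; exact: (proj_closed Hdot (L_proj HL LP)).
have closed_hyper : (forall M : set H, Man (Alg L) M ->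
    singly_generated (Alg L) M -> closed M) -> hyperatomic L.
  move=> clos; apply: (hyperatomic_of_closed Hdot HL Hsep) => x.
  by apply: clos; [exact: (cyclic_Man HL) | exists x].
have hyper_cyclic : hyperatomic L -> forall P, L P ->
    exists2 x, range P x & cyclic_manifold (Alg L) x = range P.
  move=> hL P LP; have [x Px cx] := hyperatomic_cyclic Hdot HL LP (hyp0 hL P LP).
  by exists x => //; exists x.
have cyclic_hyper : (forall P, L P ->
    exists2 x, range P x & cyclic_manifold (Alg L) x = range P) -> hyperatomic L.
  move=> cyc P LP _; have [x /(rangeP _ (L_proj HL LP)) Px cx] := cyc P LP.
  apply: (closed_cyclic_hyperatomic Hdot HL LP Px) => [Q LQ Qx y|].
    have : range P (P y) by exists y.
    by rewrite -cx => -[T /(AlgP HL)[_ TL] <-]; exact: TL.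
  by rewrite cx; exact: (proj_closed Hdot (L_proj HL LP)).
tfae.
- by move=> /Man_range/range_closed.
- by move=> clos; apply/Man_range/closed_hyper => M manM _; exact: clos.
- by move=> /range_closed clos M manM _; exact: clos.
- by move=> /closed_hyper/hyper_cyclic.
- move=> /cyclic_hyper hL; rewrite (Man_range hL) => M [P LP <-].
  by have [x _ cx] := hyper_cyclic hL P LP; exists x.
- move=> sg; apply: cyclic_hyper => P LP.
  have [x Px] := sg _ (range_Man HL LP); exists x => //.
  by rewrite Px; exact: (cyclic_self HL).
Qed.
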